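(* Let $f\colon\mathbb{R}^n\to\mathbb{R}$ be locally Lipschitz continuous, let $\Phi\colon\mathbb{R}^n\rightrightarrows\mathbb{R}^m$ be a set-valued mapping with closed graph, and let $M:=\{x\in\mathbb{R}^n\mid 0\in\Phi(x)\}$. Let $\bar x\in M$ be a local minimizer of the optimization problem $$\min f(x)\quad\text{subject to}\quad 0\in\Phi(x).$$ Then $\bar x$ is an AM-stationary point of this problem.
   Context: Normal cones: for a set $A\subset\mathbb{R}^d$ and $\bar a\in A$, the tangent (Bouligand) cone is $\mathcal{T}_A(\bar a):=\{d\mid \exists t_k\searrow 0,\ d_k\to d\colon \bar a+t_kd_k\in A\ \forall k\}$, the regular normal cone is its polar $\widehat{\mathcal{N}}_A(\bar a):=\{v\mid v^\top d\le 0\ \forall d\in\mathcal{T}_A(\bar a)\}$, and the limiting normal cone is $\mathcal{N}_A(\bar a):=\{v\mid\exists a_k\to\bar a,\ a_k\in A,\ v_k\to v,\ v_k\in\widehat{\mathcal{N}}_A(a_k)\ \forall k\}$. All these sets are empty at points outside $A$. Limiting subdifferential: $\partial f(\bar x):=\{v\in\mathbb{R}^n\mid (v,-1)\in\mathcal{N}_{\operatorname{epi}f}(\bar x,f(\bar x))\}$, where $\operatorname{epi}f:=\{(x,\alpha)\mid\alpha\ge f(x)\}$. Limiting coderivative: for $\Phi\colon\mathbb{R}^n\rightrightarrows\mathbb{R}^m$ with closed graph $\operatorname{gph}\Phi:=\{(x,y)\mid y\in\Phi(x)\}$ and $(x,y)\in\operatorname{gph}\Phi$, set $D^*\Phi(x,y)(y^*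 ):=\{x^*\in\mathbb{R}^n\mid (x^*,-y^* )\in\mathcal{N}_{\operatorname{gph}\Phi}(x,y)\}$ for $y^*\in\mathbb{R}^m$. AM-stationarity: a feasible point $\bar x\in M$ is asymptotically Mordukhovich-stationary (AM-stationary) if there exist sequences $\{x_k\},\{\varepsilon_k\}\subset\mathbb{R}^n$ and $\{y_k\},\{\lambda_k\}\subset\mathbb{R}^m$ with $(x_k,y_k)\in\operatorname{gph}\Phi$ and $\varepsilon_k\in\partial f(x_k)+D^*\Phi(x_k,y_k)(\lambda_k)$ for all $k\in\mathbb{N}$, and $x_k\to\bar x$, $\varepsilon_k\to0$, $y_k\to0$ (no convergence of $\{\lambda_k\}$ is required). *)

(* Defs.v *)
From HB Require Import structures.
From mathcomp Require Import all_boot all_order all_algebra.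
From mathcomp Require Import all_classical all_reals all_analysis.
Set Implicit Arguments.
Unset Strict Implicit.
Unset Printing Implicit Defensive.
Import Order.TTheory GRing.Theory Num.Theory.
Import numFieldNormedType.Exports.
Local Open Scope classical_set_scope.
Local Open Scope ring_scope.

(* Points of R^d are row vectors, and R^n x R^m is
   identified with R^(n + m) through row_mx. *)

Section NormalCones.
Variables (R : realType) (d : nat).
Implicit Types (A : set 'rV[R]_d) (a u v : 'rV[R]_d).

Definition dot u v : R := (u *m v^T) 0 0.

(* The conjunct A a makes each of the three cones empty at points outside A;
   in particular the regular normal cone is not the polar of the empty set
   (the whole space) there. *)
Definition tangent_cone A a : set 'rV[R]_d :=
  [set u | A a /\ exists (t : nat -> R) (u_ : nat -> 'rV[R]_d),
    [/\ (forall k, 0 < t k), t @ \oo --> (0 : R), u_ @ \oo --> u &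
        forall k, A (a + t k *: u_ k)]].

Definition regular_normal_cone A a : set 'rV[R]_d :=
  [set v | A a /\ forall u, tangent_cone A a u -> dot v u <= 0].

Definition limiting_normal_cone A a : set 'rV[R]_d :=
  [set v | A a /\ exists a_ v_ : nat -> 'rV[R]_d,
    [/\ a_ @ \oo --> a, (forall k, A (a_ k)), v_ @ \oo --> v &
        forall k, regular_normal_cone A (a_ k) (v_ k)]].

End NormalCones.

Section Subdifferential.
Variables (R : realType) (n : nat).
Implicit Types (f : 'rV[R]_n -> R) (x : 'rV[R]_n).

Definition locally_lipschitz f : Prop :=
  forall x, exists2 U : set 'rV[R]_n, nbhs x U & [lipschitz f y | y in U].

Definition epi f : set 'rV[R]_(n + 1) :=
  [set z | exists x (alpha : R), f x <= alpha /\ z = row_mx x (const_mx alpha)].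

Definition limiting_subdifferential f x : set 'rV[R]_n :=
  [set v | limiting_normal_cone (epi f)
             (row_mx x (const_mx (f x))) (row_mx v (const_mx (- 1)))].

End Subdifferential.

Section SetValued.
Variables (R : realType) (n m : nat).
Implicit Types (f : 'rV[R]_n -> R) (Phi : 'rV[R]_n -> set 'rV[R]_m).

Definition gph Phi : set 'rV[R]_(n + m) :=
  [set z | exists x y, Phi x y /\ z = row_mx x y].

Definition limiting_coderivative Phi (x : 'rV[R]_n) (y ystar : 'rV[R]_m) :
    set 'rV[R]_n :=
  [set xstar | limiting_normal_cone (gph Phi)
                 (row_mx x y) (row_mx xstar (- ystar))].

Definition feasible_set Phi : set 'rV[R]_n := [set x | Phi x 0].

Definition local_minimizer f (M : set 'rV[R]_n) (xbar : 'rV[R]_n) : Prop :=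
  M xbar /\ \forall x \near xbar, M x -> f xbar <= f x.

Definition am_stationary f Phi (xbar : 'rV[R]_n) : Prop :=
  feasible_set Phi xbar /\
  exists (x_ eps_ : nat -> 'rV[R]_n) (y_ lambda_ : nat -> 'rV[R]_m),
    [/\ forall k, gph Phi (row_mx (x_ k) (y_ k)),
        forall k,
          [set u + w | u in limiting_subdifferential f (x_ k)
                     & w in limiting_coderivative Phi (x_ k) (y_ k) (lambda_ k)]
          (eps_ k),
        x_ @ \oo --> xbar,
        eps_ @ \oo --> (0 : 'rV[R]_n) &
        y_ @ \oo --> (0 : 'rV[R]_m)].

End SetValued.

(* Main.v *)
Require Import Defs.
From mathcomp Require Import all_boot all_order all_algebra.
From mathcomp Require Import all_classical all_reals all_analysis.
From mathcomp Require Import ring lra.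
Set Implicit Arguments.
Unset Strict Implicit.
Unset Printing Implicit Defensive.
Import Order.TTheory GRing.Theory Num.Theory.
Import numFieldNormedType.Exports.
Local Open Scope classical_set_scope.
Local Open Scope ring_scope.

(* Writing w = (x, y), minimize f(x) + K/2 |y|^2 + 1/2 |x - xbar|^2 over the part
   of gph Phi in a small closed ball around (xbar, 0).  For K large the minimizer
   w0 = (x0, y0) is interior and close to (xbar, 0), and the limiting sum rule
   there gives xbar - x0 in df(x0) + D*Phi(x0, y0)(K y0); let w0 tend to (xbar, 0).

   The sum rule needs no subdifferential calculus.  Decouple the variable of f
   from w by minimizing over (z, w) the function
   f(z) + j/2 |z - x|^2 + h(w) + 1/2 |w - w0|^2.  At a minimizer, p = j (x - z) is
   a proximal subgradient of f at z, the matching vector is a proximal normal of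
   gph Phi at w, and |p| <= 2 L for a Lipschitz constant L of f.  Any cluster
   point of p as j tends to infinity is the required limiting subgradient. *)

(** * Level sets of continuous functions *)

Lemma closed_sublevel (T : topologicalType) (R : realType) (F : T -> R) (r : R) :
  continuous F -> closed [set u | F u <= r].
Proof.
move=> cF; apply: (@preimage_closed _ _ F [set x | x <= r]).
  by move=> u _; exact: cF.
exact: closed_le.
Qed.

Lemma closed_superlevel (T : topologicalType) (R : realType) (F : T -> R) (r : R) :
  continuous F -> closed [set u | r <= F u].
Proof.
move=> cF; apply: (@preimage_closed _ _ F [set x | r <= x]).
  by move=> u _; exact: cF.
exact: closed_ge.
Qed.

(** * Euclidean inner product and max norm on row vectors *)

Section Dot.
Variables (R : realType) (d : nat).
Implicit Types u v w : 'rV[R]_d.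

Lemma dotE u v : dot u v = \sum_i u 0 i * v 0 i.
Proof. by rewrite /dot mxE; apply: eq_bigr => i _; rewrite mxE. Qed.

Lemma dotC u v : dot u v = dot v u.
Proof. by rewrite !dotE; apply: eq_bigr => i _; rewrite mulrC. Qed.

Lemma dotDl u v w : dot (u + v) w = dot u w + dot v w.
Proof. by rewrite /dot mulmxDl mxE. Qed.

Lemma dotZl a u v : dot (a *: u) v = a * dot u v.
Proof. by rewrite /dot -scalemxAl mxE. Qed.

Lemma dotNl u v : dot (- u) v = - dot u v.
Proof. by rewrite -scaleN1r dotZl mulN1r. Qed.

Lemma dotDr u v w : dot u (v + w) = dot u v + dot u w.
Proof. by rewrite !(dotC u) dotDl. Qed.

Lemma dotZr a u v : dot u (a *: v) = a * dot u v.
Proof. by rewrite !(dotC u) dotZl. Qed.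

Lemma dotNr u v : dot u (- v) = - dot u v.
Proof. by rewrite !(dotC u) dotNl. Qed.

Lemma dot0l u : dot 0 u = 0.
Proof. by rewrite /dot mul0mx mxE. Qed.

Lemma dot_ge0 u : 0 <= dot u u.
Proof. by rewrite dotE sumr_ge0 // => i _; rewrite -expr2 sqr_ge0. Qed.

Lemma norm_coord_le u i : `|u 0 i| <= `|u|.
Proof.
by rewrite [leRHS]mx_normrE; apply/bigmax_geP; right; exists (0, i).
Qed.

Lemma norm_rV_le u r : 0 <= r -> (forall i, `|u 0 i| <= r) -> `|u| <= r.
Proof.
move=> r0 ur; rewrite [leLHS]mx_normrE; apply/bigmax_leP.
by split=> // -[i j] _; rewrite ord1 ur.
Qed.

(* `|u| is the max norm, [dot u u] the squared Euclidean norm. *)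
Lemma sqr_norm_le_dot u : `|u| ^+ 2 <= dot u u.
Proof.
have [->|u0] := eqVneq u 0; first by rewrite normr0 expr0n dot_ge0.
have /mx_norm_neq0[[i j] /= ue] : mx_norm u != 0.
  by rewrite -[mx_norm u]/(`|u|) normr_eq0.
rewrite [`|u|]ue ord1 -normrX ger0_norm ?sqr_ge0// dotE (bigD1 j) //= -expr2 lerDl.
by rewrite sumr_ge0 // => k _; rewrite -expr2 sqr_ge0.
Qed.

Lemma dot_le0 u : dot u u <= 0 -> u = 0.
Proof.
move=> u0; apply/eqP; rewrite -normr_eq0 -sqrf_eq0 eq_le sqr_ge0 andbT.
exact: le_trans (sqr_norm_le_dot u) u0.
Qed.

Lemma cvg_dot (T : Type) (F : set_system T) (FF : Filter F) (f g : T -> 'rV[R]_d) u v :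
  f @ F --> u -> g @ F --> v -> dot (f t) (g t) @[t --> F] --> dot u v.
Proof.
move=> fu gv; rewrite dotE; under eq_fun do rewrite dotE.
apply: cvg_big => [|i _]; first exact: add_continuous.
apply: cvgM.
- by apply: (cvg_comp f (fun x : 'rV[R]_d => x 0 i)) fu _; exact: coord_continuous.
- by apply: (cvg_comp g (fun x : 'rV[R]_d => x 0 i)) gv _; exact: coord_continuous.
Qed.

Lemma continuous_dot (T : topologicalType) (f g : T -> 'rV[R]_d) :
  continuous f -> continuous g -> continuous (fun t => dot (f t) (g t)).
Proof. by move=> cf cg t; apply: cvg_dot; [exact: cf|exact: cg]. Qed.

Lemma continuous_dist w : continuous (fun u : 'rV[R]_d => `|u - w|).
Proof. by move=> u; exact: (cvg_norm (cvgB cvg_id (cvg_cst _))). Qed.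

Lemma compact_norm_ball w r : compact [set u : 'rV[R]_d | `|u - w| <= r].
Proof.
have cl : closed [set u : 'rV[R]_d | `|u - w| <= r].
  by apply: closed_sublevel; exact: continuous_dist.
apply: bounded_closed_compact cl.
exists (`|w| + r); split; first exact: num_real.
move=> M Mr u /= ur; rewrite (le_trans _ (ltW Mr))//.
by rewrite -[u in leLHS](subrK w) addrC (le_trans (ler_normD _ _))// lerD2l.
Qed.

End Dot.

(** * Block decomposition of R^(n + m) *)

Section Blocks.
Variables (R : realType) (n m : nat).

Lemma dot_row_mx (a b : 'rV[R]_n) (c e : 'rV[R]_m) :
  dot (row_mx a c) (row_mx b e) = dot a b + dot c e.
Proof. by rewrite /dot tr_row_mx mul_row_col mxE. Qed.

Lemma norm_const_mx11 (a : R) : `|const_mx a : 'rV[R]_1| = `|a|.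
Proof.
apply/eqP; rewrite eq_le norm_rV_le/= => [|//|i]; last by rewrite mxE.
by have := norm_coord_le (const_mx a) (0 : 'I_1); rewrite mxE.
Qed.

Lemma dot_const_mx (a b : R) : dot (const_mx a : 'rV_1) (const_mx b) = a * b.
Proof. by rewrite dotE big_ord1 !mxE. Qed.

Lemma norm_row_mx (a : 'rV[R]_n) (b : 'rV[R]_m) :
  `|row_mx a b| = Num.max `|a| `|b|.
Proof.
apply/eqP; rewrite eq_le ge_max; apply/and3P; split; apply: norm_rV_le.
- by rewrite le_max normr_ge0.
- move=> i; rewrite mxE le_max.
  by case: (fintype.split i) => k; rewrite norm_coord_le ?orbT.
- exact: normr_ge0.
- by move=> i; rewrite -(row_mxEl a b) norm_coord_le.
- exact: normr_ge0.
- by move=> i; rewrite -(row_mxEr a b) norm_coord_le.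
Qed.

Lemma norm_lsubmx_le (w : 'rV[R]_(n + m)) : `|lsubmx w| <= `|w|.
Proof. by rewrite -[w in leRHS]hsubmxK norm_row_mx le_max lexx. Qed.

Lemma cvg_row_mx (T : Type) (F : set_system T) (FF : Filter F)
    (a : T -> 'rV[R]_n) (b : T -> 'rV[R]_m) (u : 'rV[R]_n) (v : 'rV[R]_m) :
  a @ F --> u -> b @ F --> v -> row_mx (a t) (b t) @[t --> F] --> row_mx u v.
Proof.
move=> au bv; apply/cvgrPdist_lt => e e0; near=> t.
rewrite opp_row_mx add_row_mx norm_row_mx gt_max; apply/andP.
by split; near: t; exact: cvgr_dist_lt.
Unshelve. all: by end_near. Qed.

Lemma dot_hsubmx (v w : 'rV[R]_(n + m)) :
  dot v w = dot (lsubmx v) (lsubmx w) + dot (rsubmx v) (rsubmx w).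
Proof. by rewrite -dot_row_mx !hsubmxK. Qed.

Lemma dot_lsubmx_le (w : 'rV[R]_(n + m)) : dot (lsubmx w) (lsubmx w) <= dot w w.
Proof. by rewrite [leRHS]dot_hsubmx lerDl dot_ge0. Qed.

End Blocks.

(** * Proximal normals and approximation of limiting normals *)

Section ProximalNormals.
Variables (R : realType) (d : nat).
Implicit Types (A : set 'rV[R]_d) (a v : 'rV[R]_d).

(** Along a tangent sequence [b - a = t k *: u_ k] the left side is of order [t k] and the right
    side of order [t k ^+ 2]. Dividing by [t k > 0] and passing to the limit leaves
    [dot v u <= 0]. *)
Lemma proximal_regular_normal A a v c : A a ->
  (\forall b \near a, A b -> dot v (b - a) <= c * dot (b - a) (b - a)) ->
  regular_normal_cone A a v.
Proof.
move=> Aa prox; split=> // u [_ [t [u_ [t0 t_0 u_u At]]]].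
have tu : a + t k *: u_ k @[k --> \oo] --> a.
  rewrite -[X in _ --> X]addr0 -[X in _ --> a + X](scale0r u).
  by apply: cvgD; [exact: cvg_cst|exact: cvgZ].
have l : dot v (u_ k) @[k --> \oo] --> dot v u.
  by apply: cvg_dot => //; exact: cvg_cst.
have r : c * (t k * dot (u_ k) (u_ k)) @[k --> \oo] --> 0.
  rewrite -[X in _ --> X](mulr0 c) -[X in _ --> c * X](mul0r (dot u u)).
  exact: (cvgM (cvg_cst c) (cvgM t_0 (cvg_dot _ u_u u_u))).
apply: (ler_cvg_to l r); near=> k.
have : A (a + t k *: u_ k) -> dot v (a + t k *: u_ k - a) <=
   c * dot (a + t k *: u_ k - a) (a + t k *: u_ k - a).
  by near: k; exact: tu prox.
move=> /(_ (At k)); rewrite addrC addKr !dotZr dotZl.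
by rewrite mulrCA ler_pM2l.
Unshelve. all: by end_near. Qed.

(** The sequences of the definition come from choosing approximants for [e = 1 / (k + 1)]. The
    epsilon form suits cluster points, since no subsequence has to be extracted. *)
Lemma limiting_normal_cone_approx A a v : A a ->
  (forall e, 0 < e -> exists b w,
    [/\ regular_normal_cone A b w, `|a - b| < e & `|v - w| < e]) ->
  limiting_normal_cone A a v.
Proof.
move=> Aa H; split=> //.
have /choice[bw Hbw] k : exists p : 'rV[R]_d * 'rV[R]_d,
    [/\ regular_normal_cone A p.1 p.2, `|a - p.1| < k.+1%:R^-1 &
        `|v - p.2| < k.+1%:R^-1].
  by have [|b [w bwP]] := H k.+1%:R^-1; [rewrite invr_gt0|exists (b, w)].
exists (fst \o bw), (snd \o bw); split=> [|k||k] /=.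
- apply/cvgrPdist_lt => e e0; near=> k; have [_ /lt_trans + _] := Hbw k; apply.
  by near: k; exact: (near_infty_natSinv_lt (PosNum e0)).
- by have [[]] := Hbw k.
- apply/cvgrPdist_lt => e e0; near=> k; have [_ _ /lt_trans +] := Hbw k; apply.
  by near: k; exact: (near_infty_natSinv_lt (PosNum e0)).
- by have [] := Hbw k.
Unshelve. all: by end_near. Qed.

End ProximalNormals.

(** Since [f x <= al] on the epigraph, the inequality for [f] becomes a proximal inequality for
    [epi f] at [(z, f z)]. Its quadratic term also contains [c * (al - f z) ^+ 2], which has the
    right sign because [0 <= c]. *)
Lemma proximal_subgradient (R : realType) (n : nat) (f : 'rV[R]_n -> R)
    (z p : 'rV[R]_n) (c : R) : 0 <= c ->
  (\forall x \near z, f z + dot p (x - z) <= f x + c * dot (x - z) (x - z)) ->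
  regular_normal_cone (epi f) (row_mx z (const_mx (f z))) (row_mx p (const_mx (- 1))).
Proof.
move=> c0 prox; apply: (@proximal_regular_normal _ _ _ _ _ c).
  by exists z, (f z).
have : \forall b \near row_mx z (const_mx (f z) : 'rV_1),
    f z + dot p (lsubmx b - z) <= f (lsubmx b) + c * dot (lsubmx b - z) (lsubmx b - z).
  move: prox; rewrite -{1}(row_mxKl z (const_mx (f z) : 'rV_1)).
  by move=> /continuous_lsubmx.
apply: filterS => b + [x [al [fx bE]]]; rewrite bE row_mxKl => H.
rewrite opp_row_mx add_row_mx !dot_row_mx -raddfB /= !dot_const_mx mulrDr.
have : 0 <= c * ((al - f z) * (al - f z)) by rewrite mulr_ge0// -expr2 sqr_ge0.
lra.
Qed.

(** * Local Lipschitz continuity, cluster points and limit estimates *)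

Lemma locally_lipschitz_ball (R : realType) (n : nat) (f : 'rV[R]_n -> R)
    (x : 'rV[R]_n) : locally_lipschitz f ->
  exists L r, [/\ 0 < L, 0 < r & forall y z, `|y - x| <= r -> `|z - x| <= r ->
    `|f y - f z| <= L * `|y - z|].
Proof.
move=> /(_ x)[U /nbhs_ballP[e /= e0 eU] /pinfty_ex_gt0[L L0 fL]].
(* Halving the radius places the closed ball inside the open ball of radius [e]. *)
exists L, (e / 2); split; rewrite ?divr_gt0// => y z yx zx.
have inU u : `|u - x| <= e / 2 -> U u.
  move=> ux; apply: eU; rewrite -ball_normE /= distrC (le_lt_trans ux)//.
  by rewrite ltr_pdivrMr// ltr_pMr// ltr1n.
exact: (fL (y, z) (conj (inU _ yx) (inU _ zx))).
Qed.

Lemma locally_lipschitz_continuous (R : realType) (n : nat) (f : 'rV[R]_n -> R) :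
  locally_lipschitz f -> continuous f.
Proof.
move=> flip x A /nbhs_ballP[e /= e0 eA].
have [L [r [L0 r0 fL]]] := locally_lipschitz_ball x flip.
apply/nbhs_ballP; exists (Num.min r (e / L)) => /=.
  by rewrite lt_min r0 divr_gt0.
move=> y; rewrite -ball_normE /= lt_min => /andP[xyr xye]; apply: eA.
rewrite -ball_normE /= (le_lt_trans (fL _ _ _ _))//.
- by rewrite subrr normr0 ltW.
- by rewrite distrC ltW.
- by rewrite mulrC -ltr_pdivlMr.
Qed.

(** Compactness of closed balls gives the cluster point. Meeting every eventual property [Q]
    arbitrarily close to [u] takes the place of a convergent subsequence. *)
Lemma bounded_seq_cluster (R : realType) (d : nat) (u_ : nat -> 'rV[R]_d) (M : R) :
  (forall k, `|u_ k| <= M) ->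
  exists u, forall (Q : set nat) e, (\forall k \near \oo, Q k) -> 0 < e ->
    exists2 k, Q k & `|u - u_ k| < e.
Proof.
move=> uM; have uoo : \forall k \near \oo, `|u_ k - 0| <= M.
  by near=> k; rewrite subr0.
have [u [_ clu]] := @compact_norm_ball R d 0 M (u_ @ \oo) _ uoo.
exists u => Q e Qoo e0.
have [|_ [[k Qk <-] ue]] := clu [set u_ k | k in Q] (ball u e) _ (nbhsx_ballx _ _ e0).
  by apply: filterS Qoo => k Qk; exists k.
by exists k => //; move: ue; rewrite -ball_normE.
Unshelve. all: by end_near. Qed.

(** Makes a closed ball constraint inactive near a point strictly inside the ball, so that
    inequalities valid on the ball become local ones. *)
Lemma near_norm_ball (R : realType) (d : nat) (u v : 'rV[R]_d) (r : R) :
  `|v - u| < r -> \forall w \near u, `|w - v| <= r.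
Proof.
move=> vur; apply/nbhs_ballP; exists (r - `|v - u|) => /=; first by rewrite subr_gt0.
move=> w; rewrite -ball_normE /= ltrBrDl => uw; rewrite distrC.
by rewrite (le_trans _ (ltW uw))// -[v - w](subrKA u) ler_normD.
Qed.

(** The quantifier over [x] stands inside [near], so the threshold on [k] is uniform in [x] and the
    bound applies to quantities that themselves depend on [k]. *)
Lemma near_natSinv_mul_lt (R : realType) (M e : R) : 0 < M -> 0 < e ->
  \forall k \near \oo, forall x : R, k.+1%:R * x <= M -> x < e.
Proof.
move=> M0 e0; have eM0 : 0 < e / M by rewrite divr_gt0.
near=> k => x; rewrite mulrC -ler_pdivlMr// => /le_lt_trans; apply.
rewrite mulrC -ltr_pdivlMr//; near: k.
exact: (near_infty_natSinv_lt (PosNum eM0)).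
Unshelve. all: by end_near. Qed.

(** * Limiting sum rule by decoupling of variables *)

Section SumRule.
Variables (R : realType) (n m : nat) (f : 'rV[R]_n -> R).
Variables (C : set 'rV[R]_(n + m)) (h : 'rV[R]_(n + m) -> R).
Variables (g : 'rV[R]_(n + m) -> 'rV[R]_(n + m)) (c : R).
Hypotheses (f_lip : locally_lipschitz f) (C_closed : closed C).
Hypotheses (h_cont : continuous h) (g_cont : continuous g).
(** A quadratic upper model with slope [g]; it turns minimality with respect to [w] into a proximal
    normal inequality. *)
Hypothesis h_quad : forall w w',
  h w' <= h w + dot (g w) (w' - w) + c * dot (w' - w) (w' - w).

(** A minimizer [(z, w)] of the decoupled function is compared with three competitors:
    [(lsubmx w0, w0)] gives the bounds, [(y, w)] the proximal subgradient inequality at [z], and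
    [(z, w')] the proximal normal inequality at [w]. *)
Lemma decoupled_minimizer (w0 : 'rV[R]_(n + m)) (r L j : R) :
  0 < r -> 0 < L -> 0 < j -> C w0 ->
  (forall y z, `|y - lsubmx w0| <= r -> `|z - lsubmx w0| <= r ->
    `|f y - f z| <= L * `|y - z|) ->
  (forall w, C w -> `|w - w0| <= r ->
    f (lsubmx w0) + h w0 <= f (lsubmx w) + h w) ->
  exists z w p,
    [/\ C w, j * `|lsubmx w - z| <= 2 * L /\ `|p| <= 2 * L,
      j * `|w - w0| ^+ 2 <= (2 * L) ^+ 2,
      forall y, `|y - lsubmx w0| <= r ->
        f z + dot p (y - z) <= f y + j / 2 * dot (y - z) (y - z) &
      forall w', C w' -> `|w' - w0| <= r ->
        dot (- g w - row_mx p 0 - (w - w0)) (w' - w)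
          <= (c + (j + 1) / 2) * dot (w' - w) (w' - w)].
Proof.
move=> r0 L0 j0 Cw0 fL w0min.
pose Psi (q : 'rV[R]_n * 'rV[R]_(n + m)) := f q.1
  + j / 2 * dot (q.1 - lsubmx q.2) (q.1 - lsubmx q.2)
  + h q.2 + 1 / 2 * dot (q.2 - w0) (q.2 - w0).
pose Z := [set z : 'rV[R]_n | `|z - lsubmx w0| <= r].
pose W := C `&` [set w | `|w - w0| <= r].
have [|||q] := @compact_EVT_min _ R Psi (Z `*` W).
- by exists (lsubmx w0, w0); split => /=; rewrite /Z/W /= ?subrr ?normr0 ?ltW//.
- apply: compact_setX; first exact: compact_norm_ball.
  by rewrite /W setIC; apply: compact_closedI => //; exact: compact_norm_ball.
- have f_cont := locally_lipschitz_continuous f_lip.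
  apply: continuous_subspaceT => q.
  have q1 : (t.1 @[t --> q]) --> q.1 by exact: cvg_fst.
  have q2 : (t.2 @[t --> q]) --> q.2 by exact: cvg_snd.
  have ql : (lsubmx t.2 @[t --> q]) --> lsubmx q.2.
    exact: (cvg_comp _ _ q2 (@continuous_lsubmx _ _ _ _ _)).
  have qf : (f t.1 @[t --> q]) --> f q.1.
    exact: (cvg_comp _ _ q1 (f_cont _)).
  have qh : (h t.2 @[t --> q]) --> h q.2 by exact: (cvg_comp _ _ q2 (@h_cont _)).
  apply: cvgD; first apply: cvgD => //; first apply: cvgD => //.
  + apply: cvgM; first exact: cvg_cst.
    by apply: cvg_dot; exact: cvgB.
  + apply: cvgM; first exact: cvg_cst.
    by apply: cvg_dot; apply: cvgB => //; exact: cvg_cst.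
case: q => z w /set_mem[Zz [Cw /= ww0]] qmin.
have {}qmin z' w' : Z z' -> C w' -> `|w' - w0| <= r -> Psi (z, w) <= Psi (z', w').
  by move=> Zz' Cw' w'w0; apply: qmin; exact/mem_set.
exists z, w, (j *: (lsubmx w - z)).
have Zw : Z (lsubmx w).
  by rewrite /Z /= -raddfB (le_trans (norm_lsubmx_le _)).
have Zw0 : Z (lsubmx w0) by rewrite /Z /= subrr normr0 ltW.
set s := `|lsubmx w - z|; have s0 : 0 <= s by exact: normr_ge0.
have sq : s ^+ 2 <= dot (z - lsubmx w) (z - lsubmx w).
  by rewrite /s distrC sqr_norm_le_dot.
have sqw : `|w - w0| ^+ 2 <= dot (w - w0) (w - w0) by exact: sqr_norm_le_dot.
(* Both quadratic terms vanish at [(lsubmx w0, w0)]. Minimality of [w0] against [w] cancels [h], and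
   what remains is [f (lsubmx w) - f z <= L * s]. *)
have key : j / 2 * s ^+ 2 + 1 / 2 * `|w - w0| ^+ 2 <= L * s.
  have := qmin _ _ Zw0 Cw0; rewrite subrr normr0 => /(_ (ltW r0)).
  rewrite /Psi /= !subrr !dot0l.
  have := w0min _ Cw ww0; have := fL _ _ Zw Zz.
  rewrite -/s ler_norml => /andP[_].
  have : j * s ^+ 2 <= j * dot (z - lsubmx w) (z - lsubmx w) by rewrite ler_pM2l.
  lra.
have js : j * s <= 2 * L.
  have [->|sn0] := eqVneq s 0; first by rewrite mulr0 mulr_ge0// ltW.
  have {}s0 : 0 < s by rewrite lt_def sn0.
  rewrite -(ler_pM2r s0).
  have : 0 <= `|w - w0| ^+ 2 by rewrite sqr_ge0.
  lra.
split=> //.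
- by rewrite normrZ gtr0_norm.
(* Multiplying [key] by [j] and inserting [j * s <= 2 * L] bounds [j / 2 * |w - w0| ^+ 2] by
   [2 * L ^+ 2]. *)
- have : j * (j / 2 * s ^+ 2 + 1 / 2 * `|w - w0| ^+ 2) <= j * (L * s).
    by rewrite ler_pM2l.
  have : 0 <= j * (j * s ^+ 2) by rewrite !mulr_ge0 ?sqr_ge0// ltW.
  have : L * (j * s) <= L * (2 * L) by rewrite ler_pM2l.
  lra.
- move=> y Zy; have := qmin _ _ Zy Cw ww0; rewrite /Psi /=.
  have -> : y - lsubmx w = (y - z) + (z - lsubmx w) by rewrite addrA subrK.
  rewrite -(opprB z (lsubmx w)); move: (y - z) (z - lsubmx w) => a b.
  rewrite !(dotDl, dotDr, dotZl, dotNl) (dotC b a); lra.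
- move=> w' Cw' w'w0; have := qmin _ _ Zz Cw' w'w0; rewrite /Psi /=.
  have := h_quad w w'; have := dot_lsubmx_le (w' - w).
  have -> : w' - w0 = (w' - w) + (w - w0) by rewrite addrA subrK.
  have -> : z - lsubmx w' = (z - lsubmx w) - lsubmx (w' - w).
    by rewrite raddfB /= opprB addrA subrK.
  have dot3 p : dot (- g w - row_mx p 0 - (w - w0)) (w' - w) =
      - dot (g w) (w' - w) - dot p (lsubmx (w' - w)) - dot (w - w0) (w' - w).
    rewrite !(dotDl, dotNl) -[in dot (row_mx p 0) _](hsubmxK (w' - w)) dot_row_mx.
    by rewrite dot0l addr0.
  (* Scaling the bound on the first block of [w' - w] by [j] leaves an inequality linear in the
     products that occur. *)
  rewrite dot3 -(opprB z (lsubmx w)) -(ler_pM2l j0).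
  move: (w' - w) (w - w0) (z - lsubmx w) => a b e; move: (lsubmx a) => la.
  rewrite !(dotDl, dotDr, dotZl, dotNl, dotNr) (dotC la e) (dotC b a).
  lra.
Qed.


(** The weights [j = k + 1] force [w_ k] to [w0] and [z_ k] to [lsubmx w0], while [p_ k] stays
    bounded by [2 * L]. One cluster point [p] serves both cones, because the proximal subgradient
    and the proximal normal share the same [p_ k]. *)
Lemma limiting_sum_rule (w0 : 'rV[R]_(n + m)) : C w0 ->
  (\forall w \near w0, C w -> f (lsubmx w0) + h w0 <= f (lsubmx w) + h w) ->
  exists2 p, limiting_subdifferential f (lsubmx w0) p &
    limiting_normal_cone C w0 (- g w0 - row_mx p 0).
Proof.
move=> Cw0 /nbhs_ballP[r1 /= r10 w0min].
have [L [r2 [L0 r20 fL]]] := locally_lipschitz_ball (lsubmx w0) f_lip.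
pose r := Num.min (r1 / 2) r2.
have r0 : 0 < r by rewrite lt_min r20 divr_gt0.
have {}w0min w : C w -> `|w - w0| <= r -> f (lsubmx w0) + h w0 <= f (lsubmx w) + h w.
  move=> Cw; rewrite le_min => /andP[wr _]; apply: w0min => //.
  by rewrite -ball_normE /= distrC (le_lt_trans wr)// ltr_pdivrMr// ltr_pMr// ltr1n.
have {}fL y z : `|y - lsubmx w0| <= r -> `|z - lsubmx w0| <= r ->
    `|f y - f z| <= L * `|y - z|.
  by rewrite !le_min => /andP[_ yr] /andP[_ zr]; exact: fL.
have /choice[t Ht] (k : nat) : exists q : 'rV[R]_n * 'rV[R]_(n + m) * 'rV[R]_n,
    [/\ C q.1.2, k.+1%:R * `|lsubmx q.1.2 - q.1.1| <= 2 * L /\ `|q.2| <= 2 * L,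
      k.+1%:R * `|q.1.2 - w0| ^+ 2 <= (2 * L) ^+ 2,
      forall y, `|y - lsubmx w0| <= r -> f q.1.1 + dot q.2 (y - q.1.1) <=
         f y + k.+1%:R / 2 * dot (y - q.1.1) (y - q.1.1) &
      forall w', C w' -> `|w' - w0| <= r ->
        dot (- g q.1.2 - row_mx q.2 0 - (q.1.2 - w0)) (w' - q.1.2)
          <= (c + (k.+1%:R + 1) / 2) * dot (w' - q.1.2) (w' - q.1.2)].
  have [z [w [p H]]] := decoupled_minimizer r0 L0 (ltr0Sn R k) Cw0 fL w0min.
  by exists (z, w, p).
pose z_ k := (t k).1.1; pose w_ k := (t k).1.2; pose p_ k := (t k).2.
have w_cvg : w_ @ \oo --> w0.
  apply/cvgrPdist_lt => e e0; near=> k.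
  rewrite distrC -(ltr_pXn2r (n := 2)) ?nnegrE ?normr_ge0 ?ltW//.
  have [_ _ + _ _] := Ht k; move: (`|_| ^+ 2).
  by near: k; apply: near_natSinv_mul_lt; rewrite exprn_gt0// mulr_gt0.
have lw_cvg : lsubmx (w_ k) @[k --> \oo] --> lsubmx w0.
  exact: (cvg_comp _ _ w_cvg (@continuous_lsubmx _ _ _ _ _)).
have z_cvg : z_ @ \oo --> lsubmx w0.
  apply/cvgrPdist_lt => e e0; have e20 : 0 < e / 2 by rewrite divr_gt0.
  near=> k.
  have [_ [+ _] _ _ _] := Ht k; rewrite -/(w_ k) -/(z_ k).
  rewrite -[lsubmx w0 - z_ k](subrKA (lsubmx (w_ k))) => kwz.
  rewrite (le_lt_trans (ler_normD _ _))// [ltRHS](splitr e) ltrD//.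
    by near: k; exact: (cvgr_dist_lt _ _ lw_cvg _ e20).
  move: (`|_|) kwz; near: k.
  by apply: near_natSinv_mul_lt => //; rewrite mulr_gt0.
have pL k : `|p_ k| <= 2 * L by have [_ []] := Ht k.
have [p pP] := bounded_seq_cluster pL.
have f_cont := locally_lipschitz_continuous f_lip.
have fz_cvg : f (z_ k) @[k --> \oo] --> f (lsubmx w0).
  exact: (cvg_comp _ _ z_cvg (f_cont _)).
have gw_cvg : g (w_ k) @[k --> \oo] --> g w0.
  exact: (cvg_comp _ _ w_cvg (@g_cont _)).
exists p; apply: limiting_normal_cone_approx => //.
- by exists (lsubmx w0), (f (lsubmx w0)).
- move=> e e0.
  have : \forall k \near \oo, [/\ `|lsubmx w0 - z_ k| < r, `|lsubmx w0 - z_ k| < e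
      & `|f (lsubmx w0) - f (z_ k)| < e].
    near=> k; split; near: k; exact: cvgr_dist_lt.
  move=> /pP /(_ e0)[k [zr ze fze] pe].
  exists (row_mx (z_ k) (const_mx (f (z_ k)))), (row_mx (p_ k) (const_mx (- 1))).
  split.
  + apply: (@proximal_subgradient _ _ _ _ _ (k.+1%:R / 2)); first by rewrite divr_ge0.
    have [_ _ _ H _] := Ht k.
    by apply: filterS (near_norm_ball zr) => y; exact: H.
  + by rewrite opp_row_mx add_row_mx norm_row_mx gt_max ze -raddfB norm_const_mx11.
  + by rewrite opp_row_mx add_row_mx norm_row_mx gt_max pe -raddfB subrr raddf0 normr0.
(* The error in the normal vector has three parts, from [g], from [p] and from [w_ k - w0]; each
   receives a third of [e]. *)
- move=> e e0; have e30 : 0 < e / 3 by rewrite divr_gt0.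
  have : \forall k \near \oo, [/\ `|w0 - w_ k| < r, `|w0 - w_ k| < e / 3,
      `|w0 - w_ k| < e & `|g w0 - g (w_ k)| < e / 3].
    near=> k; split; near: k; exact: cvgr_dist_lt.
  move=> /pP /(_ e30)[k [wr we3 we ge3] pe].
  exists (w_ k), (- g (w_ k) - row_mx (p_ k) 0 - (w_ k - w0)); split=> //.
  + have [Cwk _ _ _ H] := Ht k.
    apply: (@proximal_regular_normal _ _ _ _ _ (c + (k.+1%:R + 1) / 2)) => //.
    by apply: filterS (near_norm_ball wr) => y; move=> /[swap]; exact: H.
  + have -> : - g w0 - row_mx p 0 - (- g (w_ k) - row_mx (p_ k) 0 - (w_ k - w0))
        = - (g w0 - g (w_ k)) - row_mx (p - p_ k) 0 - (w0 - w_ k).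
      rewrite -[X in row_mx (p - _) X]subr0 -add_row_mx -opp_row_mx.
      move: (row_mx p 0) (row_mx (p_ k) 0) => P Q.
      by apply/rowP => i; rewrite !mxE; ring.
    have : `|row_mx (p - p_ k) 0 : 'rV[R]_(n + m)| < e / 3.
      by rewrite norm_row_mx gt_max pe normr0.
    have := ler_normD (- (g w0 - g (w_ k)) - row_mx (p - p_ k) 0) (- (w0 - w_ k)).
    have := ler_normD (- (g w0 - g (w_ k))) (- row_mx (p - p_ k) 0 : 'rV[R]_(n + m)).
    rewrite !normrN; lra.
Unshelve. all: by end_near. Qed.

End SumRule.

(** * Quadratic penalty and its local minimizers *)

Definition penalty (R : realType) (n m : nat) (K : R) (xbar : 'rV[R]_n)
    (w : 'rV[R]_(n + m)) : R :=
  K / 2 * dot (rsubmx w) (rsubmx w)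
  + 1 / 2 * dot (lsubmx w - xbar) (lsubmx w - xbar).

Section Penalty.
Variables (R : realType) (n m : nat) (xbar : 'rV[R]_n).
Implicit Types (K : R) (w : 'rV[R]_(n + m)).

Lemma penalty_continuous K : continuous (penalty K xbar : 'rV[R]_(n + m) -> R).
Proof.
suff H (T : topologicalType) (a : T -> 'rV[R]_m) (b : T -> 'rV[R]_n) :
    continuous a -> continuous b -> continuous (fun t =>
      K / 2 * dot (a t) (a t) + 1 / 2 * dot (b t - xbar) (b t - xbar)).
  by apply: H; [exact: continuous_rsubmx|exact: continuous_lsubmx].
move=> a_cont b_cont t; apply: cvgD; apply: cvgM; try exact: cvg_cst.
  by apply: cvg_dot; exact: a_cont.
by apply: cvg_dot; apply: cvgB (cvg_cst _); exact: b_cont.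
Qed.

Definition penalty_grad K w : 'rV[R]_(n + m) :=
  row_mx (lsubmx w - xbar) (K *: rsubmx w).

Lemma penalty_grad_continuous K : continuous (penalty_grad K).
Proof.
suff H (T : topologicalType) (a : T -> 'rV[R]_m) (b : T -> 'rV[R]_n) :
    continuous a -> continuous b ->
    continuous (fun t => row_mx (b t - xbar) (K *: a t)).
  by apply: H; [exact: continuous_rsubmx|exact: continuous_lsubmx].
move=> a_cont b_cont t; apply: cvg_row_mx.
  by apply: cvgB (cvg_cst _); exact: b_cont.
by apply: cvgZ; [exact: cvg_cst|exact: a_cont].
Qed.

(** The expansion of a quadratic function is exact, with remainder [K / 2] and [1 / 2] times the
    squared blocks of [w' - w]; both coefficients are at most [(K + 1) / 2]. *)
Lemma penalty_quadratic K w w' : 0 <= K ->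
  penalty K xbar w' <= penalty K xbar w
    + dot (penalty_grad K w) (w' - w)
    + (K + 1) / 2 * dot (w' - w) (w' - w).
Proof.
move=> K0; rewrite !(dot_hsubmx _ (w' - w)) /penalty_grad row_mxKl row_mxKr.
rewrite /penalty dotZl.
have -> : lsubmx w' - xbar = lsubmx (w' - w) + (lsubmx w - xbar).
  by rewrite raddfB addrA subrK.
have -> : rsubmx w' = rsubmx (w' - w) + rsubmx w by rewrite raddfB subrK.
have : 0 <= K * dot (lsubmx (w' - w)) (lsubmx (w' - w)) by rewrite mulr_ge0// dot_ge0.
have := dot_ge0 (rsubmx (w' - w)).
move: (lsubmx (w' - w)) (rsubmx (w' - w)) (lsubmx w - xbar) (rsubmx w) => a b d e.
rewrite !(dotDl, dotDr) (dotC a d) (dotC b e); lra.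
Qed.

(** A minimizer over a small compact piece of [C] is local once it avoids the bounding sphere. A
    large [K] ensures this by raising the objective above its value [f xbar] at the center
    everywhere on the sphere. *)
Lemma penalized_local_minimizer (f : 'rV[R]_n -> R) (C : set 'rV[R]_(n + m)) e :
  continuous f -> closed C -> C (row_mx xbar 0) ->
  (\forall x \near xbar, C (row_mx x 0) -> f xbar <= f x) -> 0 < e ->
  exists K w0, [/\ 0 <= K, C w0, `|row_mx xbar 0 - w0| < e &
    \forall w \near w0, C w ->
      f (lsubmx w0) + penalty K xbar w0 <= f (lsubmx w) + penalty K xbar w].
Proof.
move=> f_cont C_closed Cbar /nbhs_ballP[d /= d0 xbar_min] e0.
set wbar := row_mx xbar 0 in Cbar *.
pose r := Num.min (e / 2) (d / 2).
have r0 : 0 < r by rewrite lt_min !divr_gt0.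
have re : r < e by rewrite gt_min ltr_pdivrMr// ltr_pMr// ltr1n.
have rd : r < d by rewrite gt_min [X in _ || X]ltr_pdivrMr// ltr_pMr// ltr1n orbT.
have fl_cont : continuous (fun w : 'rV[R]_(n + m) => f (lsubmx w)).
  by move=> w; exact: (cvg_comp _ _ (@continuous_lsubmx _ _ _ _ w) (@f_cont _)).
have contD (T : topologicalType) (F G : T -> R) :
    continuous F -> continuous G -> continuous (fun t => F t + G t).
  by move=> F_cont G_cont t; apply: cvgD; [exact: F_cont|exact: G_cont].
pose B := C `&` [set w | `|w - wbar| <= r].
have Bbar : B wbar by split=> //=; rewrite subrr normr0 ltW.
have B_compact : compact B.
  by rewrite /B setIC; apply: compact_closedI => //; exact: compact_norm_ball.
have compact_min (A : set 'rV[R]_(n + m)) F : continuous F -> compact A -> A !=set0 ->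
    exists2 u, A u & forall w, A w -> F u <= F w :> R.
  move=> F_cont A_compact A0.
  have [//|//||u /set_mem Au umin] := @compact_EVT_min _ R F A.
    exact: continuous_subspaceT.
  by exists u => // w Aw; apply: umin; exact/mem_set.
(* The points of the sphere not already excluded with [K = 0]; only these constrain the choice of
   [K]. *)
pose D := B `&` ([set w | f (lsubmx w) + penalty 0 xbar w <= f xbar]
                 `&` [set w | r <= `|w - wbar|]).
have D_compact : compact D.
  apply: compact_closedI => //; apply: closedI.
    by apply: closed_sublevel; apply: contD => //; exact: penalty_continuous.
  by apply: closed_superlevel; exact: continuous_dist.
have pen_bar K : penalty K xbar wbar = 0.
  by rewrite /penalty row_mxKl row_mxKr subrr !dot0l !mulr0 addr0.
have penE K w : penalty K xbar w = penalty 0 xbar w + K / 2 * dot (rsubmx w) (rsubmx w).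
  by rewrite /penalty !mul0r add0r addrC.
have [K [K0 KD]] : exists K, 0 <= K /\
    forall w, D w -> f xbar < f (lsubmx w) + penalty K xbar w.
  have [D0|/set0P D0] := eqVneq D set0; first by exists 0; split=> // w; rewrite D0.
  have y_cont : continuous (fun w : 'rV[R]_(n + m) => dot (rsubmx w) (rsubmx w)).
    by apply: continuous_dot; exact: continuous_rsubmx.
  have [u Du umin] := compact_min D _ y_cont D_compact D0.
  have [v Bv vmin] := compact_min B _ fl_cont B_compact (ex_intro _ _ Bbar).
  (* If the second block of [u] were zero, its first block would be feasible and close to [xbar].
     Local minimality and the term [1 / 2 * |x - xbar| ^+ 2] would then force [u = wbar], which is
     off the sphere. *)
  have mu0 : 0 < dot (rsubmx u) (rsubmx u).
    rewrite ltNge; apply/negP => /dot_le0 u0.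
    case: Du => -[Cu ur] [/= fu ru].
    have uE : u = row_mx (lsubmx u) 0 by rewrite -u0 hsubmxK.
    have lur : `|lsubmx u - xbar| <= r.
      by rewrite -(row_mxKl xbar (0 : 'rV_m)) -raddfB (le_trans (norm_lsubmx_le _)).
    have : f xbar <= f (lsubmx u).
      apply: xbar_min; last by rewrite -uE.
      by rewrite -ball_normE /= distrC (le_lt_trans lur).
    move: fu; rewrite /penalty !mul0r add0r => fu fxu.
    have /dot_le0/subr0_eq ul : dot (lsubmx u - xbar) (lsubmx u - xbar) <= 0 by lra.
    by move: ru; rewrite uE ul subrr normr0 leNgt r0.
  have vbar : f (lsubmx v) <= f xbar by have := vmin _ Bbar; rewrite row_mxKl.
  (* With [f (lsubmx v)] the minimum of [f] on [B] and [dot (rsubmx u) (rsubmx u)] the minimum of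
     the squared second block on [D], this [K] lifts the objective on [D] to at least
     [f xbar + 1]. *)
  exists (2 * (f xbar - f (lsubmx v) + 1) / dot (rsubmx u) (rsubmx u)); split.
    by rewrite divr_ge0 ?dot_ge0// mulr_ge0// addr_ge0// subr_ge0.
  move=> w Dw; rewrite penE.
  have vw : f (lsubmx v) <= f (lsubmx w) by apply: vmin; case: Dw.
  have p0 : 0 <= penalty 0 xbar w.
    by rewrite /penalty !mul0r add0r mulr_ge0// dot_ge0.
  have : f xbar - f (lsubmx v) + 1 <= 2 * (f xbar - f (lsubmx v) + 1) /
       dot (rsubmx u) (rsubmx u) / 2 * dot (rsubmx w) (rsubmx w).
    set a := f xbar - f (lsubmx v) + 1.
    have -> : 2 * a / dot (rsubmx u) (rsubmx u) / 2 * dot (rsubmx w) (rsubmx w)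
        = a * (dot (rsubmx w) (rsubmx w) / dot (rsubmx u) (rsubmx u)).
      by field; rewrite gt_eqF.
    rewrite ler_peMr ?ler_pdivlMr ?mul1r ?umin//.
    by rewrite addr_ge0// subr_ge0.
  lra.
have obj_cont : continuous (fun w => f (lsubmx w) + penalty K xbar w).
  by apply: contD => //; exact: penalty_continuous.
have [w0 Bw0 w0min] := compact_min B _ obj_cont B_compact (ex_intro _ _ Bbar).
have w0bar : f (lsubmx w0) + penalty K xbar w0 <= f xbar.
  by have := w0min _ Bbar; rewrite pen_bar row_mxKl addr0.
(* On the sphere [w0] would lie in [D], as the penalty increases with [K], and its value would
   exceed [f xbar]. *)
have w0r : `|wbar - w0| < r.
  rewrite ltNge; apply/negP => rw0.
  have : D w0.
    split=> //; split; last by rewrite /= distrC.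
    rewrite /= (le_trans _ w0bar)// lerD2l (penE K) lerDl.
    by rewrite mulr_ge0 ?dot_ge0// divr_ge0.
  by move=> /KD; rewrite ltNge w0bar.
exists K, w0; split=> //; first by case: Bw0.
  exact: lt_trans re.
by apply: filterS (near_norm_ball w0r) => w wr Cw; exact: w0min.
Qed.

End Penalty.

(** * Asymptotic stationarity from penalized minimizers *)

Theorem theorem3p2 (R : realType) (n m : nat)
    (f : 'rV[R]_n -> R) (Phi : 'rV[R]_n -> set 'rV[R]_m) (xbar : 'rV[R]_n)
    (f_lip : locally_lipschitz f)
    (Phi_closed : closed (gph Phi))
    (xbar_min : local_minimizer f (feasible_set Phi) xbar) :
  am_stationary f Phi xbar.
Proof.
have gphE x y : gph Phi (row_mx x y) -> Phi x y.
  by move=> [a [b [ab /eq_row_mx[-> ->]]]].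
case: xbar_min => xbarM xbar_min; split=> //.
have Cbar : gph Phi (row_mx xbar 0) by exists xbar, 0.
have {}xbar_min : \forall x \near xbar, gph Phi (row_mx x 0) -> f xbar <= f x.
  by apply: filterS xbar_min => x xmin /gphE; exact: xmin.
have f_cont := locally_lipschitz_continuous f_lip.
have /choice[q qP] (k : nat) : exists q : 'rV[R]_(n + m) * 'rV[R]_m,
    [/\ gph Phi q.1, `|row_mx xbar 0 - q.1| < k.+1%:R^-1 &
      [set u + v | u in limiting_subdifferential f (lsubmx q.1)
        & v in limiting_coderivative Phi (lsubmx q.1) (rsubmx q.1) q.2]
      (xbar - lsubmx q.1)].
  have k0 : 0 < k.+1%:R^-1 :> R by rewrite invr_gt0.
  have [K [w [K0 Cw wk wmin]]] :=
    penalized_local_minimizer f_cont Phi_closed Cbar xbar_min k0.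
  have [p pf pC] := limiting_sum_rule f_lip Phi_closed
    (@penalty_continuous _ _ _ xbar K) (@penalty_grad_continuous _ _ _ xbar K)
    (fun w w' => penalty_quadratic xbar w w' K0) Cw wmin.
  (* The second block of the negative gradient is [- (K *: rsubmx w)], so the sign convention of the
     coderivative makes [K *: rsubmx w] the multiplier. As [K] varies freely with [k], the
     multipliers may be unbounded. *)
  exists (w, K *: rsubmx w); split=> //=.
  exists p => //; exists (xbar - lsubmx w - p); last by rewrite addrC subrK.
  move: pC; rewrite /limiting_coderivative /= hsubmxK /penalty_grad.
  by rewrite !opp_row_mx add_row_mx opprB subr0.
have q_cvg : (q k).1 @[k --> \oo] --> (row_mx xbar 0 : 'rV[R]_(n + m)).
  apply/cvgrPdist_lt => e e0; near=> k; have [_ /lt_trans + _] := qP k; apply.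
  by near: k; exact: (near_infty_natSinv_lt (PosNum e0)).
have x_cvg : lsubmx (q k).1 @[k --> \oo] --> xbar.
  rewrite -[X in _ --> X](row_mxKl xbar (0 : 'rV_m)).
  exact: (cvg_comp _ _ q_cvg (@continuous_lsubmx _ _ _ _ _)).
exists (fun k => lsubmx (q k).1), (fun k => xbar - lsubmx (q k).1),
  (fun k => rsubmx (q k).1), (fun k => (q k).2); split=> //.
- by move=> k; rewrite hsubmxK; have [] := qP k.
- by move=> k; have [] := qP k.
- by rewrite -(subrr xbar); apply: cvgB x_cvg; exact: cvg_cst.
- rewrite -[X in _ --> X](row_mxKr xbar (0 : 'rV_m)).
  exact: (cvg_comp _ _ q_cvg (@continuous_rsubmx _ _ _ _ _)).
Unshelve. all: by end_near. Qed.
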